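(* The standard ternary Cantor set $C\subseteq\mathbb{R}$ is Haar-$2$ but not Haar-$1$ (as a subset of the group $\mathbb{R}$).
   Context: A Cantor set is a homeomorphic copy of $2^\omega$. For $n\geq 1$, a set $A\subseteq\mathbb{R}$ is Haar-$n$ if there are a Borel set $B\subseteq\mathbb{R}$ with $A\subseteq B$ and a Cantor set $D\subseteq\mathbb{R}$ such that $|(D+x)\cap B|\leq n$ for all $x\in\mathbb{R}$. *)

(* Defs.v *)
From HB Require Import structures.
From mathcomp Require Import all_boot all_order all_algebra.
From mathcomp Require Import all_classical all_reals all_analysis.

Set Implicit Arguments.
Unset Strict Implicit.
Unset Printing Implicit Defensive.

Import Order.TTheory GRing.Theory Num.Theory.
Import numFieldNormedType.Exports.

Local Open Scope classical_set_scope.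
Local Open Scope card_scope.
Local Open Scope ring_scope.

(* [f] is a homeomorphism of 2^omega onto [D], with inverse the restriction of
   [g] to [D]; [D] carries the subspace topology. *)
Definition cantor_set (R : realType) (D : set R) : Prop :=
  exists (f : cantor_space -> R) (g : R -> cantor_space),
    [/\ continuous f, range f = D, cancel f g & {within D, continuous g}].

Definition borel_set (R : realType) (B : set R) : Prop := <<s [set U : set R | open U] >> B.

(* [`I_n] is the set of naturals smaller than [n], so [_ #<= `I_n] says that a
   set has at most [n] elements. *)
Definition Haar (R : realType) (n : nat) (A : set R) : Prop :=
  exists B D : set R,
    [/\ borel_set B, A `<=` B, cantor_set D
      & forall x : R, [set d + x | d in D] `&` B #<= `I_n].

(* Middle-thirds construction: each of the two outer thirds of the unit interval
   receives a scaled copy of the previous stage [E]. *)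
Definition ternary_step (R : realType) (E : set R) : set R :=
  [set t / 3 | t in E] `|` [set (2 + t) / 3 | t in E].

Definition ternary_cantor (R : realType) : set R :=
  \bigcap_(n in [set: nat]) iter n (@ternary_step R) `[0, 1]%classic.

Arguments ternary_cantor : clear implicits.

(* Main.v *)
(* Not Haar-1: every real of [-1, 1] is a difference of two points of C, and a
   Cantor set has two distinct points at distance at most 1, so a translate moves
   both of them into C.

   Haar-2: for n > 0, 3^n C lies in 6Z + [0, 3], a half circle of the circle R/6Z.
   Take for D the set of the sums of 2 u_k / 27^(k+1), where the digits u_k are
   continuous functions from 2^omega to {0, 1, 2} such that any three distinct
   points are mapped to 0, 1, 2 by some u_k. Then any three distinct points of D
   are almost equally spaced modulo 6 at some scale 27^(k+1), and no translation
   brings them all into a half circle. *)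
Require Import Defs.
From mathcomp Require Import all_boot all_order all_algebra.
From mathcomp Require Import all_classical all_reals all_analysis.
From mathcomp Require Import ring lra zify.

Set Implicit Arguments.
Unset Strict Implicit.
Unset Printing Implicit Defensive.

Import Order.TTheory GRing.Theory Num.Theory.
Import numFieldNormedType.Exports.

Local Open Scope classical_set_scope.
Local Open Scope card_scope.
Local Open Scope ring_scope.

(** * Small cardinalities and decreasing intersections *)

Lemma card_le_I1P (T : Type) (A : set T) :
  A #<= `I_1 -> forall x y, A x -> A y -> x = y.
Proof.
move=> /pcard_leP/injfunPex[f fA finj] x y Ax Ay.
apply: finj; rewrite ?inE//.
by have := fA _ Ax; have := fA _ Ay => /=; case: (f x); case: (f y).
Qed.

Lemma card_le_I2 (T : Type) (A : set T) :
  (forall x y z, A x -> A y -> A z -> x <> y -> x <> z -> y <> z -> False) ->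
  A #<= `I_2.
Proof.
move=> A3.
have [->|/set0P[x Ax]] := eqVneq A set0; first exact: card_ge0.
have AI2 y : (forall z, A z -> z = x \/ z = y) -> A #<= `I_2.
  move=> Axy; apply: (card_le_trans (B := (fun n => if n is 0%N then x else y) @` `I_2)).
    by apply: subset_card_le => z /Axy[]->; [exists 0%N|exists 1%N].
  exact: card_image_le.
have [[y [Ay yx]]|noy] := pselect (exists y, A y /\ y <> x).
  apply: (AI2 y) => z Az; apply: contrapT => /not_orP[zx zy].
  by apply: (A3 x y z) => // /esym.
by apply: (AI2 x) => z Az; left; apply: contrapT => zx; apply: noy; exists z.
Qed.

(** Among finitely many [F n], the one of largest index lies in all the others, which yields the
    finite intersection property. *)
Lemma compact_bigcap_decr (T : ptopologicalType) (K : set T) (F : nat -> set T) :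
    compact K -> (forall n, closed (F n)) ->
    {homo F : m n / (m <= n)%N >-> n `<=` m} ->
  (forall n, (K `&` F n) !=set0) -> (\bigcap_n (K `&` F n)) !=set0.
Proof.
move=> cK cF decF KF0; move: cK; rewrite compact_In0; apply.
  by exists F.
move=> D _; have [x [Kx Fx]] := KF0 (\max_(i <- finmap.enum_fset D) i)%N.
by exists x => i /= iD; split=> //; apply: decF Fx; exact: (@leq_bigmax_seq _ _ xpredT id).
Qed.

(** * Stages of the ternary Cantor set and their differences *)

Section TernaryCantor.
Context {R : realType}.
Implicit Types (x t a c : R) (E F : set R).

Local Notation stage n := (iter n (@ternary_step R) `[0, 1]%classic).

Lemma ternary_stepP E x : ternary_step E x <-> E (3 * x) \/ E (3 * x - 2).
Proof.
split=> [[][t Et <-]|[]Ex].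
- by left; have -> : 3 * (t / 3) = t by field.
- by right; have -> : 3 * ((2 + t) / 3) - 2 = t by field.
- by left; exists (3 * x) => //; field.
- by right; exists (3 * x - 2) => //; field.
Qed.

Lemma ternary_step_subset E F : E `<=` F -> ternary_step E `<=` ternary_step F.
Proof. by move=> EF x /ternary_stepP[]/EF ?; apply/ternary_stepP; [left|right]. Qed.

Lemma closed_ternary_step E : closed E -> closed (ternary_step E).
Proof.
move=> cE.
have -> : ternary_step E = ( *%R 3 @^-1` E) `|` ((fun x => 3 * x - 2) @^-1` E).
  by apply/seteqP; split=> x /ternary_stepP.
apply: closedU; apply: preimage_closed => // x _.
  exact: mulrl_continuous.
by apply: cvgB; [exact: mulrl_continuous|exact: cvg_cst].
Qed.

Lemma closed_stage n : closed (stage n).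
Proof. by elim: n => [|n IH]; [exact: interval_closed|exact: closed_ternary_step]. Qed.

Lemma closed_ternary_cantor : closed (ternary_cantor R).
Proof. by apply: closed_bigI => n _; exact: closed_stage. Qed.

Lemma stage_decr : {homo (fun n => stage n) : m n / (m <= n)%N >-> n `<=` m}.
Proof.
have step n : stage n.+1 `<=` stage n.
  elim: n => [x /ternary_stepP|n IH]; last exact: ternary_step_subset.
  by rewrite /= !in_itv /=; lra.
apply: homo_leq => // [A|B A C BA CB]; [exact: subset_refl|exact: subset_trans CB BA].
Qed.

(** The intervals of stage [n] have length 3^-n, and the ternary digits of their left ends are 0 or
    2, so these ends become even integers after scaling by 3^n. *)
Lemma stage_expand n c : stage n c ->
  exists (m : nat) t, [/\ 0 <= t, t <= 1 & 3 ^+ n * c = 2 * m%:R + t].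
Proof.
elim: n c => [c|n IH c /ternary_stepP[]/IH[m [t [t0 t1 nc]]]].
- by rewrite /= in_itv /= => /andP[c0 c1]; exists 0%N, c; split=> //; ring.
- by exists m, t; split=> //; rewrite exprSr -mulrA.
- exists (m + 3 ^ n)%N, t; split=> //.
  by rewrite exprSr -mulrA natrD natrX; lra.
Qed.

(** Choosing the outer thirds that receive the two points turns [a] into [3 * a + 2], [3 * a - 2] or
    [3 * a] one stage earlier, and one of these is again in [-1, 1]. *)
Lemma stage_sub n a : -1 <= a <= 1 -> exists2 x, stage n x & stage n (x + a).
Proof.
elim: n a => [a /andP[a1 a2]|n IH a /andP[a1 a2]].
  by exists (Num.max 0 (- a)); rewrite /= in_itv /=; case: (lerP 0 (- a)); lra.
have [a_lo|a_hi|a_mid] : [\/ a <= - (1 / 3), 1 / 3 <= a | -1 <= 3 * a <= 1].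
- by have [?|?] := leP a (- (1 / 3)); [constructor 1|
    have [?|?] := leP (1 / 3) a; [constructor 2|constructor 3; lra]].
- have [|x xn xan] := IH (3 * a + 2); first lra.
  exists ((2 + x) / 3); apply/ternary_stepP; [right|left].
    by have -> : 3 * ((2 + x) / 3) - 2 = x by field.
  by have -> : 3 * ((2 + x) / 3 + a) = x + (3 * a + 2) by field.
- have [|x xn xan] := IH (3 * a - 2); first lra.
  exists (x / 3); apply/ternary_stepP; [left|right].
    by have -> : 3 * (x / 3) = x by field.
  by have -> : 3 * (x / 3 + a) - 2 = x + (3 * a - 2) by field.
- have [x xn xan] := IH _ a_mid.
  exists (x / 3); apply/ternary_stepP; left.
    by have -> : 3 * (x / 3) = x by field.
  by have -> : 3 * (x / 3 + a) = x + 3 * a by field.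
Qed.

(** The points [x] that suit stage [n] form decreasing nonempty closed sets, so compactness gives an
    [x] that suits all stages. *)
Lemma ternary_cantor_sub a : -1 <= a <= 1 ->
  exists2 x, ternary_cantor R x & ternary_cantor R (x + a).
Proof.
move=> a1; pose F n := stage n `&` ((fun x => x + a) @^-1` stage n).
have [|||n|x xF] := @compact_bigcap_decr _ `[(0 : R), 1] F.
- exact: segment_compact.
- move=> n; apply: closedI; first exact: closed_stage.
  apply: preimage_closed; last exact: closed_stage.
  by move=> x _; apply: cvgD; [exact: cvg_id|exact: cvg_cst].
- by move=> m n mn x [/(stage_decr mn) ? /(stage_decr mn)].
- have [x xn xan] := stage_sub n a1.
  by exists x; split=> //; exact: (stage_decr (leq0n n)).
by exists x => n _; have [_ []] := xF n I.
Qed.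

End TernaryCantor.

(** * Expansions in base 27 with digits 0, 2, 4 *)

Section Expansion.
Context {R : realType}.
Implicit Types u v : nat -> nat.

(** The base is a power of 3, to match the stages. After scaling by 27^(k+1), the digits before
    [u k] contribute multiples of 54, hence of 6, and those after it at most 4/26 = 2/13 when all
    are at most 2. *)
Definition expansion u : R := limn (series (fun k => 2 * (u k)%:R / 27 ^+ k.+1 : R)).

Let term u k : R := 2 * (u k)%:R / 27 ^+ k.+1.

Let term_ge0 u k : 0 <= term u k.
Proof. by rewrite divr_ge0// ?mulr_ge0// exprn_ge0. Qed.

Let term_le u k : (forall k, u k <= 2)%N -> term u k <= geometric (4 / 27) (1 / 27) k.
Proof.
move=> u2; rewrite /term /geometric /= expr_div_n expr1n exprS.
have : (u k)%:R <= 2 :> R by rewrite ler_nat.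
have : 0 < 27 ^+ k :> R by rewrite exprn_gt0.
move: (27 ^+ k) => b b0 uk.
rewrite ler_pdivrMr ?mulr_gt0//.
have -> : 4 / 27 * (1 / b) * (27 * b) = 4 by field; lra.
lra.
Qed.

Let cvg_geo : series (geometric (4 / 27) (1 / 27)) @ \oo --> (2 / 13 : R).
Proof.
have -> : 2 / 13 = (4 / 27) / (1 - 1 / 27) :> R by field.
by apply: cvg_geometric_series; rewrite ger0_norm; lra.
Qed.

Let cvg_term u : (forall k, u k <= 2)%N -> cvgn (series (term u)).
Proof.
move=> u2; apply: (@series_le_cvg _ _ (geometric (4 / 27) (1 / 27))) => [k|k|k|].
- exact: term_ge0.
- exact: le_trans (term_ge0 u k) (term_le k u2).
- exact: term_le.
- by apply/cvg_ex; eexists; exact: cvg_geo.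
Qed.

Lemma expansion_bounds u : (forall k, u k <= 2)%N -> 0 <= expansion u <= 2 / 13.
Proof.
move=> u2; apply/andP; split.
  apply: limr_ge; first exact: cvg_term.
  by apply: nearW => n; apply: sumr_ge0 => k _; exact: term_ge0.
rewrite -(cvg_lim _ cvg_geo)//; apply: lim_series_le.
- exact: cvg_term.
- by apply/cvg_ex; eexists; exact: cvg_geo.
- by move=> k; exact: term_le.
Qed.

Lemma expansionS u : (forall k, u k <= 2)%N ->
  27 * expansion u = 2 * (u 0)%:R + expansion (fun k => u k.+1).
Proof.
move=> u2.
suff : series (term u) @ \oo --> (2 * (u 0)%:R + expansion (fun k => u k.+1)) / 27.
  by move=> /cvg_lim; rewrite /expansion => ->//; field.
rewrite -cvg_shiftS.
have -> : [sequence series (term u) n.+1]_n =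
    (fun n => (2 * (u 0)%:R + series (term (fun k => u k.+1)) n) / 27).
  apply/funext => n; rewrite /= /series /= big_nat_recl//= mulrDl mulr_suml /term expr1.
  by congr (_ + _); apply: eq_bigr => k _; rewrite [27 ^+ k.+2]exprS invfM; ring.
apply: cvgM; last exact: cvg_cst.
by apply: cvgD; [exact: cvg_cst|exact: (cvg_term (fun k => u2 k.+1))].
Qed.

(** The integer [m] is chosen before [v]: sequences with the same first [n] digits share it, and it
    cancels in their difference. *)
Lemma expansion_drop n u : (forall k, u k <= 2)%N -> exists m : nat,
  forall v, (forall k, v k <= 2)%N -> (forall k, (k < n)%N -> v k = u k) ->
  27 ^+ n * expansion v = 2 * m%:R + expansion (fun k => v (n + k)%N).
Proof.
elim: n u => [|n IH] u u2; first by exists 0%N => v _ _; rewrite expr0 mul1r mulr0 add0r.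
have [m mP] := IH _ (fun k => u2 k.+1).
exists (27 ^ n * u 0 + m)%N => v v2 vu.
rewrite exprSr -mulrA expansionS// mulrDr (mP (fun k => v k.+1))//; last first.
  by move=> k kn; apply: vu.
rewrite (vu 0%N)// natrD natrM natrX.
have -> : (fun k => v (n + k).+1) = (fun k => v (n.+1 + k)%N) by [].
ring.
Qed.

Lemma expansion_digit n u : (forall k, u k <= 2)%N ->
  exists (m : nat) (e : R), [/\ 0 <= e, e <= 2 / 13 &
  27 ^+ n.+1 * expansion u = 6 * m%:R + 2 * (u n)%:R + e].
Proof.
move=> u2; have [m /(_ u u2 (fun _ _ => erefl)) mP] := expansion_drop n u2.
have /andP[e0 e1] := expansion_bounds (fun k => u2 (n + k.+1)%N).
(* Dropping [n] digits leaves [2 * m], and the last factor 27 makes it 54 m = 6 (9 m). *)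
exists (9 * m)%N, (expansion (fun k => u (n + k.+1)%N)); split=> //.
rewrite exprS -mulrA mP mulrDr expansionS//= addn0 natrM; ring.
Qed.

Lemma expansion_close n u v :
    (forall k, u k <= 2)%N -> (forall k, v k <= 2)%N ->
    (forall k, (k < n)%N -> v k = u k) ->
  `|expansion u - expansion v| <= (1 / 27) ^+ n.
Proof.
move=> u2 v2 uv; have [m mP] := expansion_drop n u2.
have /andP[eu0 eu1] := expansion_bounds (fun k => u2 (n + k)%N).
have /andP[ev0 ev1] := expansion_bounds (fun k => v2 (n + k)%N).
have b0 : 0 < 27 ^+ n :> R by rewrite exprn_gt0.
rewrite expr_div_n expr1n ler_pdivlMr// -(gtr0_norm b0) -normrM mulrC mulrBr.
rewrite (mP u)// (mP v)// ler_norml; lra.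
Qed.

End Expansion.

(** * Digit functions on binary sequences *)

(* The digits run over all pairs [(p, q)] of finite words: 0 on the extensions of
   [p], 1 on the other extensions of [q], 2 elsewhere. *)
Definition prefix_digit (pq : seq bool * seq bool) (a : nat -> bool) : nat :=
  if mkseq a (size pq.1) == pq.1 then 0%N
  else if mkseq a (size pq.2) == pq.2 then 1%N else 2%N.

Definition digits (a : nat -> bool) (k : nat) : nat :=
  if unpickle k is Some pq then prefix_digit pq a else 0%N.

Lemma digits_le2 a k : (digits a k <= 2)%N.
Proof.
by rewrite /digits; case: unpickle => // pq; rewrite /prefix_digit; case: ifP => // _; case: ifP.
Qed.

Lemma neq_mkseq (a b : nat -> bool) : a <> b ->
  exists n, mkseq b n <> mkseq a n.
Proof.
move=> ab; have [n abn] : exists n, a n <> b n.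
  by apply/existsNP => eqab; apply: ab; apply/funext.
exists n.+1 => /(congr1 (fun s => nth false s n)).
by rewrite !nth_mkseq// => /esym.
Qed.

Lemma digits_separate2 (a b : nat -> bool) : a <> b ->
  exists k, digits a k = 0%N /\ digits b k = 1%N.
Proof.
(* Every sequence extends the empty word, so [b] gets 1 once it fails to extend the prefix of
   [a]. *)
move=> /neq_mkseq[n abn]; exists (pickle (mkseq a n, [::] : seq bool)).
rewrite /digits !pickleK /prefix_digit /= size_mkseq eqxx.
by rewrite (introF eqP abn).
Qed.

Lemma digits_separate3 (a b c : nat -> bool) : a <> b -> a <> c -> b <> c ->
  exists k, [/\ digits a k = 0%N, digits b k = 1%N & digits c k = 2%N].
Proof.
move=> ab ac bc.
have [n abn] := neq_mkseq ab; have [m acm] := neq_mkseq ac.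
have [l bcl] := neq_mkseq bc.
have eq_take d e i j : (i <= j)%N -> mkseq d j = mkseq e j -> mkseq d i = mkseq e i :> seq bool.
  move=> ij /(congr1 (take i)).
  by rewrite /mkseq -!map_take take_iota (minn_idPl ij).
(* The first word is long enough to exclude both [b] and [c], the second to exclude [c]; by
   [eq_take], prefixes that differ still differ when lengthened. *)
exists (pickle (mkseq a (maxn n m), mkseq b l)).
rewrite /digits !pickleK /prefix_digit /= !size_mkseq !eqxx.
rewrite (introF eqP (contra_not (eq_take _ _ _ _ (leq_maxl n m)) abn)).
rewrite (introF eqP (contra_not (eq_take _ _ _ _ (leq_maxr n m)) acm)).
by rewrite (introF eqP bcl).
Qed.

(** A digit reads no further than the longer word of its pair. This is the source of the continuity
    of [sparse]. *)
Lemma digits_local (n : nat) : exists N, forall a b : nat -> bool,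
  (forall i, (i < N)%N -> a i = b i) ->
  forall k, (k < n)%N -> digits a k = digits b k.
Proof.
elim: n => [|n [N IH]]; first by exists 0%N.
pose l := if unpickle n is Some pq
  then let: (p, q) := pq : seq bool * seq bool in maxn (size p) (size q) else 0%N.
exists (maxn N l) => a b ab k.
rewrite ltnS leq_eqVlt => /predU1P[->|]; last first.
  by apply: IH => i iN; apply: ab; rewrite leq_max iN.
rewrite /digits; case E : unpickle => [[p q]|//].
have eq_mk i : (i <= l)%N -> mkseq a i = mkseq b i.
  move=> il; apply/eq_in_map => j; rewrite mem_iota /= => ji.
  by apply: ab; rewrite leq_max (leq_trans ji il) orbT.
by rewrite /prefix_digit /= !eq_mk// /l E ?leq_maxl ?leq_maxr.
Qed.

Lemma near_prefix (a : cantor_space) N :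
  \forall b \near a, forall i, (i < N)%N -> b i = a i.
Proof.
elim: N => [|N IH]; first by near=> b.
have aN : \forall b \near a, b N = a N.
  exact: (@proj_continuous _ _ N a [set a N] (discrete_set1 _)).
near=> b => i; rewrite ltnS leq_eqVlt => /predU1P[->|iN].
- by near: b.
- by move: i iN; near: b.
Unshelve. all: by end_near. Qed.

(** * The sparse Cantor set and its translates *)

Section SparseCantorSet.
Context {R : realType}.

Definition sparse (a : cantor_space) : R := expansion (digits a).

Lemma sparse_continuous : continuous sparse.
Proof.
move=> a; apply/cvgrPdist_le => e e0.
have : geometric 1 (1 / 27) @ \oo --> (0 : R).
  by apply: cvg_geometric; rewrite ger0_norm; lra.
move=> /cvgrPdist_le/(_ e e0)[n _ /(_ n (leqnn n))].
rewrite /= sub0r normrN mul1r ger0_norm ?exprn_ge0; last lra.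
move=> ne; have [N dN] := digits_local n.
near=> b; apply: le_trans ne; apply: expansion_close => [k|k|k kn]; try exact: digits_le2.
apply: dN kn => i; move: i; near: b; exact: near_prefix.
Unshelve. all: by end_near. Qed.

Lemma sparse_mod6 a k : exists (m : nat) (e : R), [/\ 0 <= e, e <= 2 / 13 &
  27 ^+ k.+1 * sparse a = 6 * m%:R + 2 * (digits a k)%:R + e].
Proof. exact: (expansion_digit k (digits_le2 a)). Qed.

Lemma sparse_inj : injective sparse.
Proof.
move=> a b sab; apply: contrapT => /digits_separate2[k [ak bk]].
have [m [e [e0 e1]]] := sparse_mod6 a k; have [n [f [f0 f1]]] := sparse_mod6 b k.
rewrite sab ak bk => -> eqmn.
(* Here 6 m - 6 n = 2 + f - e, which is within 2/13 of 2 and so cannot be a multiple of 6. *)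
have : (6 * n < 6 * m < 6 * n + 6)%N.
  by rewrite -!(ltr_nat R) natrD !natrM; lra.
by lia.
Qed.

Lemma ternary_mod6 k (c : R) : ternary_cantor R c ->
  exists (m : nat) t, [/\ 0 <= t, t <= 3 & 27 ^+ k.+1 * c = 6 * m%:R + t].
Proof.
(* One stage short of 3 (k + 1): the remaining factor 3 turns [2 * m + t] into 6 m + 3 t. *)
move=> /(_ (3 * k + 2)%N I)/stage_expand[m [t [t0 t1 ct]]].
exists m, (3 * t); split; try lra.
have -> : 27 ^+ k.+1 = 3 * 3 ^+ (3 * k + 2) :> R.
  rewrite -exprS (_ : (3 * k + 2).+1 = 3 * k.+1)%N; last lia.
  by rewrite exprM; congr (_ ^+ _); ring.
by rewrite -mulrA ct; ring.
Qed.

Lemma eq_of_natr_close (m n : nat) : m%:R < n%:R + 1 :> R -> n%:R < m%:R + 1 :> R -> m = n.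
Proof. by rewrite !natr1 !ltr_nat; lia. Qed.

Lemma sparse_ternary_translate (x : R) a b c : a <> b -> a <> c -> b <> c ->
  ternary_cantor R (sparse a + x) -> ternary_cantor R (sparse b + x) ->
  ternary_cantor R (sparse c + x) -> False.
Proof.
move=> ab ac bc; have [k [ak bk ck]] := digits_separate3 ab ac bc.
move=> /(ternary_mod6 k)[m0 [t0 [t00 t01 E0]]].
move=> /(ternary_mod6 k)[m1 [t1 [t10 t11 E1]]].
move=> /(ternary_mod6 k)[m2 [t2 [t20 t21 E2]]].
have [n0 [e0 [e00 e01]]] := sparse_mod6 a k.
have [n1 [e1 [e10 e11]]] := sparse_mod6 b k.
have [n2 [e2 [e20 e21]]] := sparse_mod6 c k.
rewrite ak bk ck => F2 F1 F0; move: E0 E1 E2; rewrite !mulrDr F0 F1 F2.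
move: (27 ^+ k.+1 * x) => y E0 E1 E2.
(* The difference of [E1] and [E0] makes 6 times the defect equal to 2 + (e1 - e0) - (t1 - t0),
   strictly between -6 and 6; the same holds for [E2] and [E1]. *)
have m01 : (m0 + n1 = m1 + n0)%N.
  clear E2; apply: eq_of_natr_close; rewrite !natrD; lra.
have m12 : (m1 + n2 = m2 + n1)%N.
  clear E0; apply: eq_of_natr_close; rewrite !natrD; lra.
(* Between the outer points the digit gap 4 exceeds what [t2 - t0] <= 3 and the errors absorb, so
   the defect is positive, against the sum of [m01] and [m12]. *)
have : (m0 + n2 < m2 + n0)%N by clear E1; rewrite -(ltr_nat R) !natrD; lra.
lia.
Qed.

End SparseCantorSet.

(** * Cantor sets on the line and the two halves of the theorem *)

(** The inverse is continuous because [f] is a closed map: closed subsets of Cantor space are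
    compact, and so are their images. *)
Lemma cantor_set_range (R : realType) (f : cantor_space -> R) :
  continuous f -> injective f -> cantor_set (range f).
Proof.
move=> cf fi; pose g y := xget point (f @^-1` [set y]).
have fK : cancel f g.
  by move=> a; apply: fi; apply: (@xgetPex _ point (f @^-1` [set f a])); exists a.
move: g fK => g fK; exists f, g; split=> //.
apply/continuous_closedP => A cA; apply/closed_subspaceP; exists (f @` A).
  apply: compact_closed; first exact: norm_hausdorff.
  apply: continuous_compact; first exact: continuous_subspaceT.
  by apply: (subclosed_compact cA cantor_space_compact).
apply/seteqP; split=> [y [[a Aa <-] _]|y [gA [a _ eqa]]].
  by split; [rewrite /from_subspace /= fK|exists a].
by move: gA; rewrite -eqa /from_subspace /= fK => Aa; split; exists a.
Qed.

Lemma Haar2_ternary_cantor (R : realType) : Haar 2 (ternary_cantor R).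
Proof.
exists (ternary_cantor R), (range (@sparse R)); split=> //.
- rewrite -[ternary_cantor R]setCK; apply: sigma_algebraC.
  by apply: sub_sigma_algebra; apply: closed_openC; exact: closed_ternary_cantor.
- by apply: cantor_set_range; [exact: sparse_continuous|exact: sparse_inj].
move=> x; apply: card_le_I2.
move=> _ _ _ [[_ [a _ <-] <-] Ca] [[_ [b _ <-] <-] Cb] [[_ [c _ <-] <-] Cc].
by move=> ab ac bc; apply: (sparse_ternary_translate _ _ _ Ca Cb Cc) => [E|E|E];
  [apply: ab|apply: ac|apply: bc]; rewrite E.
Qed.

(** Cantor space is perfect, so points other than [a] come arbitrarily near [a], and [f] is
    continuous and injective. *)
Lemma cantor_set_close_points (R : realType) (D : set R) (e : R) :
  cantor_set D -> 0 < e -> exists x y, [/\ D x, D y, x <> y & `|x - y| <= e].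
Proof.
move=> [f [g [cf <- fK _]]] e0; pose a : cantor_space := point.
have fe : \forall b \near a, `|f a - f b| <= e.
  by have /cvgrPdist_le := cf a; exact.
have [_ perf] := cantor_perfect.
have : limit_point [set: cantor_space] a by rewrite perf.
move=> /(_ _ fe)[b [/eqP ba _ ?]].
by exists (f a), (f b); split=> // /(can_inj fK)/esym.
Qed.

Lemma not_Haar1_ternary_cantor (R : realType) : ~ Haar 1 (ternary_cantor R).
Proof.
move=> [B [D [_ CB cD DB]]].
have [x [y [Dx Dy xy]]] := cantor_set_close_points cD ltr01.
rewrite distrC ler_norml => /ternary_cantor_sub[c Cc Cyx].
have [Bx By] := (CB _ Cc, CB _ Cyx).
(* Translation by [c - x] takes [x] to [c] and [y] to [c + (y - x)], both in the Cantor set and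
   hence in [B]. *)
apply: xy; apply: (@addIr _ (c - x)).
apply: (card_le_I1P (DB (c - x))); split=> //.
- by exists x.
- by rewrite addrC subrK.
- by exists y.
- by move: By; congr B; ring.
Qed.

Theorem theorem4p1 (R : realType) :
  Haar 2 (ternary_cantor R) /\ ~ Haar 1 (ternary_cantor R).
Proof. by split; [exact: Haar2_ternary_cantor|exact: not_Haar1_ternary_cantor]. Qed.
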